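(* Let $\mathcal{G}^{gr}$ be the infinite dimensional Grassmann algebra $\mathcal{G}=\langle 1,e_1,e_2,\dots\mid e_ie_j=-e_je_i\rangle$ with the grading whose even part is spanned by the monomials in the $e_i$ of even length and whose odd part is spanned by those of odd length. Then for $n\ge 1$: (1) $c_n^{gr,z}(\mathcal{G}^{gr})=\sum_{1\le i\le n,\ i\text{ odd}}\binom{n}{i}=2^{n-1}$ and $\delta_n^{gr}(\mathcal{G}^{gr})=\sum_{0\le i\le n,\ i\text{ even}}\binom{n}{i}=2^{n-1}$; (2) $\chi_n^{gr,z}(\mathcal{G}^{gr})=\sum_{1\le i\le n,\ i\text{ odd}}\chi_{(n-i),(1^i)}$ and $\chi_n(\Delta^{gr}(\mathcal{G}^{gr}))=\sum_{0\le i\le n,\ i\text{ even}}\chi_{(n-i),(1^i)}$.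
   Context: $F$ is a field of characteristic zero. A superalgebra is an algebra $A=A_0\oplus A_1$ with $A_iA_j\subseteq A_{i+j\bmod 2}$; $Z(A)$ is the center. $F\langle Y,Z\rangle$ is the free algebra on even variables $y_1,y_2,\dots$ and odd variables $z_1,z_2,\dots$. $\mathrm{Id}^{gr}(A)$ is the set of graded identities; $C^{gr}(A)$ is the set of central graded polynomials (zero constant term, all evaluations with even variables in $A_0$ and odd in $A_1$ lie in $Z(A)$). $P_n^{gr}$ is the span of monomials $w_{\sigma(1)}\cdots w_{\sigma(n)}$, $\sigma\in S_n$, $w_i\in\{y_i,z_i\}$; $c_n^{gr,z}(A)=\dim P_n^{gr}/(P_n^{gr}\cap C^{gr}(A))$, $\delta_n^{gr}(A)=\dim(P_n^{gr}\cap C^{gr}(A))/(P_n^{gr}\cap\mathrm{Id}^{gr}(A))$. $\mathbb{Z}_2\wr S_n$ acts on $P_n^{gr}$ by $(a_1,\dots,a_n;\sigma)y_i=y_{\sigma(i)}$, $(a_1,\dots,a_n;\sigma)z_i=a_{\sigma(i)}z_{\sigma(i)}$ ($a_j=\pm1$); $\chi_n^{gr,z}(A)$ and $\chi_n(\Delta^{gr}(A))$ denote the characters of $P_n^{gr}/(P_n^{gr}\cap C^{gr}(A))$ and $(P_n^{gr}\cap C^{gr}(A))/(P_n^{gr}\cap\mathrm{Id}^{gr}(A))$. $\chi_{\lambda,\mu}$ is the irreducible $\mathbb{Z}_2\wr S_n$-character indexed by $\lambda\vdash n-r$ (even variables) and $\mu\vdash r$ (odd variables); $1^i$ denotes the partition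 with $i$ parts equal to $1$. *)

(* Defs.v *)
From HB Require Import structures.
From mathcomp Require Import all_boot all_order all_algebra all_fingroup.
From mathcomp Require Import finmap.
Set Implicit Arguments. Unset Strict Implicit. Unset Printing Implicit Defensive.
Import Order.TTheory GRing.Theory.
Local Open Scope fset_scope.
Local Open Scope ring_scope.

Section Grassmann.
Variable F : fieldType.

(** The infinite dimensional Grassmann algebra G over F, generated by
    e_0, e_1, e_2, ... (indexing from 0 instead of 1 is immaterial).
    A vector x is given by its coordinates on the monomial basis
    e_S = e_{s_1} ... e_{s_k} (s_1 < ... < s_k), S a finite set of indices;
    elements of G are those with finite support. *)
Definition gvec := {fset nat} -> F.

Definition finsupp (x : gvec) : Prop :=
  exists s : seq {fset nat}, forall S, x S != 0 -> S \in s.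

(** e_T e_U = (-1)^{#{(t,u) | t in T, u in U, u < t}} e_{T cup U} for
    disjoint T, U. *)
Definition gsign (T U : {fset nat}) : F :=
  (-1) ^+ (\sum_(t <- enum_fset T) \sum_(u <- enum_fset U) (u < t)%N)%N.

Definition gmul (x y : gvec) : gvec := fun S =>
  \sum_(T <- enum_fset (fpowerset S)) gsign T (S `\` T) * x T * y (S `\` T).

Definition gone : gvec := fun S => if S == fset0 then 1 else 0.

Definition in_G (x : gvec) : Prop := finsupp x.
Definition in_G0 (x : gvec) : Prop :=
  finsupp x /\ forall S, odd #|` S| -> x S = 0.
Definition in_G1 (x : gvec) : Prop :=
  finsupp x /\ forall S, ~~ odd #|` S| -> x S = 0.

Definition in_center (z : gvec) : Prop :=
  in_G z /\ forall y, in_G y -> gmul z y = gmul y z.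

(** P_n^gr: the basis monomials are indexed by (eps, s) with eps : 'I_n -> bool
    and s in S_n; it is the monomial w_{s(0)} w_{s(1)} ... w_{s(n-1)} where
    w_j = y_j if eps j = false and w_j = z_j if eps j = true. *)
Definition mon_index (n : nat) := ({ffun 'I_n -> bool} * 'S_n)%type.
Definition Pn (n : nat) := {ffun mon_index n -> F^o}.

Definition gvar n (eps : {ffun 'I_n -> bool}) (ya za : 'I_n -> gvec) j :=
  if eps j then za j else ya j.

Definition eval_mon n (m : mon_index n) (ya za : 'I_n -> gvec) : gvec :=
  \big[gmul/gone]_(k < n) gvar m.1 ya za (m.2 k).

Definition eval_poly n (f : Pn n) (ya za : 'I_n -> gvec) : gvec := fun S =>
  \sum_(m : mon_index n) f m * eval_mon m ya za S.

Definition graded_assignment n (ya za : 'I_n -> gvec) : Prop :=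
  (forall j, in_G0 (ya j)) /\ (forall j, in_G1 (za j)).

(** f in P_n^gr lies in C^gr(G^gr) (central graded polynomial; the constant
    term of a multilinear polynomial is zero). *)
Definition central_poly n (f : Pn n) : Prop :=
  forall ya za, graded_assignment ya za -> in_center (eval_poly f ya za).

Definition identity_poly n (f : Pn n) : Prop :=
  forall ya za, graded_assignment ya za -> eval_poly f ya za = (fun _ => 0).

(** The wreath product Z_2 wr S_n: (a; s) with a : 'I_n -> bool, where
    a j = true stands for a_j = -1. *)
Definition wr (n : nat) := ({ffun 'I_n -> bool} * 'S_n)%type.
Definition sgnb (b : bool) : F := (-1) ^+ b.

(** Action on P_n^gr:  (a; s) y_j = y_{s j},  (a; s) z_j = a_{s j} z_{s j},
    extended multiplicatively to monomials and linearly. *)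
Definition wact n (g : wr n) (f : Pn n) : Pn n :=
  [ffun m : mon_index n =>
     let eps' := [ffun j => m.1 (g.2 j)] in
     let s' := (m.2 * (g.2)^-1)%g in
     (\prod_(j < n | eps' j) sgnb (g.1 (g.2 j))) * f (eps', s')].

(** Group law making wact a (left) action:
    (a; s)(b; t) = (c; s o t), c k = a k * b (s^-1 k). *)
Definition wmul n (g h : wr n) : wr n :=
  ([ffun k => g.1 k (+) h.1 ((g.2)^-1%g k)], (h.2 * g.2)%g).
Definition winv n (g : wr n) : wr n :=
  ([ffun k => g.1 (g.2 k)], (g.2)^-1%g).

(** Trace of the action of g on a subspace U of P_n^gr (U is invariant in
    all uses below). *)
Definition trace_on n (U : {vspace Pn n}) (g : wr n) : F :=
  \sum_(j < \dim U) coord (vbasis U) j (wact g (vbasis U)`_j).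

(** chi_{(n-i),(1^i)}: the irreducible character of Z_2 wr S_n induced from
    the Young subgroup H = (Z_2 wr S_{n-i}) x (Z_2 wr S_i) (first n-i and last
    i positions) of the linear character
    psi = (trivial character chi_{(n-i),()} of Z_2 wr S_{n-i}) (x)
          (character chi_{(),(1^i)} of Z_2 wr S_i: (a;t) |-> a_1...a_i sgn(t)). *)
Definition in_last n i (k : 'I_n) : bool := (n - i <= k)%N.

Definition in_young n i (g : wr n) : bool :=
  [forall k : 'I_n, in_last i (g.2 k) == in_last i k].

Definition sgn_last n i (s : 'S_n) : F :=
  (-1) ^+ #|[set jk : 'I_n * 'I_n | [&& in_last i jk.1, in_last i jk.2,
                                       (jk.1 < jk.2)%N & (s jk.2 < s jk.1)%N]]|.

Definition psi_young n i (g : wr n) : F :=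
  if in_young i g then
    (\prod_(k < n | in_last i k) sgnb (g.1 k)) * sgn_last i g.2
  else 0.

Definition chi_hook n i (g : wr n) : F :=
  (#|[pred h : wr n | in_young i h]|%:R)^-1 *
  \sum_(x : wr n) psi_young i (wmul (winv x) (wmul g x)).

End Grassmann.

(* Main.v *)
Require Import Defs.
From HB Require Import structures.
From mathcomp Require Import all_boot all_order all_algebra all_fingroup.
From mathcomp Require Import finmap.
From mathcomp Require Import ring.
From Stdlib Require Import FunctionalExtensionality.
Import GRing.Theory.
Set Implicit Arguments.
Unset Strict Implicit.
Unset Printing Implicit Defensive.
Local Open Scope fset_scope.
Local Open Scope ring_scope.

(** Homogeneous elements of the Grassmann algebra commute up to the sign
    (-1)^{ab}. On a word eps of even and odd variables, a multilinear f
    therefore evaluates to L_eps(f) times the ordered product of its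
    variables, where L_eps(f) sums the coefficients of f weighted by the sign
    of the permutation of the odd variables. Testing on y_j = 1, z_j = e_j, f is
    an identity iff every L_eps(f) vanishes, and central iff L_eps(f) vanishes
    for all eps with an odd number of odd variables. The ordered monomials are
    dual to the L_eps, so codimensions count words by parity, and the trace of g
    on each quotient is a signed sum over the words fixed by g. Grouped by
    weight i, this is the character of the representation induced from the
    stabilizer of a word, that is chi_{(n-i),(1^i)}. *)

(** * Signs, products and parity in the Grassmann algebra *)

Section GrassmannAlgebra.
Variable F : fieldType.
Implicit Types (x y z : gvec F) (S T U W : {fset nat}).

Definition gscale (a : F) x : gvec F := fun S => a * x S.

Definition homogeneous (b : bool) x := forall S, odd #|` S| != b -> x S = 0.

Definition gbasis (S : {fset nat}) : gvec F := fun T => if T == S then 1 else 0.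

Lemma gscaleA a b x : gscale a (gscale b x) = gscale (a * b) x.
Proof. by apply: functional_extensionality => S; rewrite /gscale mulrA. Qed.

Lemma gscale1 x : gscale 1 x = x.
Proof. by apply: functional_extensionality => S; rewrite /gscale mul1r. Qed.

Lemma gmul_scaler a x y : gmul x (gscale a y) = gscale a (gmul x y).
Proof.
apply: functional_extensionality => S; rewrite /gmul /gscale mulr_sumr.
by apply: eq_bigr => T _; rewrite mulrCA.
Qed.

Lemma gsign_split T U W : U `<=` W ->
  gsign F T W = gsign F T U * gsign F T (W `\` U).
Proof.
move=> sUW; rewrite /gsign -exprD -big_split; congr (_ ^+ _).
apply: eq_bigr => t _; rewrite -big_cat; apply: perm_big.
apply: uniq_perm; first exact: fset_uniq.
  rewrite cat_uniq !fset_uniq andbT; apply/hasPn => u /=.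
  by rewrite in_fsetD => /andP[].
move=> u; rewrite mem_cat /= in_fsetD.
by case: (boolP (u \in U)) => //= /(fsubsetP sUW).
Qed.

(** As [T] and [U] are disjoint, each pair is counted by exactly one of the two exponents, so these
    add up to the product of the cardinals. *)
Lemma gsignC T U : [disjoint T & U]%fset ->
  gsign F T U * gsign F U T = (-1) ^+ (odd #|` T| && odd #|` U|).
Proof.
move=> dTU; rewrite -oddM signr_odd /gsign -exprD; congr (_ ^+ _).
rewrite [X in (_ + X)%N]exchange_big -big_split /=.
rewrite big_seq (eq_bigr (fun=> #|` U|)) => [|t tT].
  by rewrite -big_seq big_const_seq count_predT iter_addn_0 mulnC.
rewrite -big_split /= big_seq (eq_bigr (fun=> 1%N)) => [|u uU].
  by rewrite -big_seq big_const_seq count_predT iter_addn_0 mul1n.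
case: ltngtP => // ut; move: uU; rewrite ut => uU.
by move/fdisjointP: dTU => /(_ t tT); rewrite uU.
Qed.

Lemma gsignK T U : gsign F T U * gsign F T U = 1.
Proof. by rewrite /gsign -expr2 sqrr_sign. Qed.

(** Trades a range depending on [T] for a side condition on a fixed range, so that nested sums can
    be exchanged. *)
Lemma big_fpowersetD S T (g : {fset nat} -> F) :
  \sum_(U <- enum_fset (fpowerset (S `\` T))) g U =
  \sum_(U <- enum_fset (fpowerset S) | [disjoint T & U]%fset) g U.
Proof.
rewrite -[RHS]big_filter; apply: perm_big; apply: uniq_perm.
- exact: fset_uniq.
- by rewrite filter_uniq // fset_uniq.
move=> U; rewrite mem_filter /= !fpowersetE fsubsetD fdisjoint_sym.
by rewrite andbC.
Qed.

(* Both sides are sums over ordered pairs of disjoint subsets of the support,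
   so the graded commutation needs no associativity. *)
Lemma gmul_lcomm a b x y z : homogeneous a x -> homogeneous b y ->
  gmul x (gmul y z) = gscale ((-1) ^+ (a && b)) (gmul y (gmul x z)).
Proof.
move=> hx hy; apply: functional_extensionality => S.
rewrite /gscale /gmul mulr_sumr.
pose G T U := gsign F T (S `\` T) * x T *
  (gsign F U (S `\` T `\` U) * y U * z (S `\` T `\` U)).
pose H U T := (-1) ^+ (a && b) * (gsign F U (S `\` U) * y U *
  (gsign F T (S `\` U `\` T) * x T * z (S `\` U `\` T))).
rewrite (eq_bigr (fun T => \sum_(U <- enum_fset (fpowerset S) |
   [disjoint T & U]%fset) G T U)); last first.
  by move=> T _; rewrite mulr_sumr -big_fpowersetD.
rewrite [RHS](eq_bigr (fun U => \sum_(T <- enum_fset (fpowerset S) |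
   [disjoint U & T]%fset) H U T)); last first.
  by move=> T _; rewrite mulr_sumr mulr_sumr -big_fpowersetD.
rewrite (exchange_big_dep predT) //= big_seq [RHS]big_seq.
apply: eq_bigr => U; rewrite fpowersetE => sUS; rewrite big_seq_cond [RHS]big_seq_cond.
apply: eq_big => T; first by rewrite fdisjoint_sym.
rewrite fpowersetE => /andP[sTS dTU]; rewrite /G /H.
have [oT|/hx->] := eqVneq (odd #|` T|) a; last by rewrite !(mul0r, mulr0).
have [oU|/hy->] := eqVneq (odd #|` U|) b; last by rewrite !(mul0r, mulr0).
have sTD : T `<=` S `\` U by rewrite fsubsetD sTS.
have sUD : U `<=` S `\` T by rewrite fsubsetD sUS fdisjoint_sym.
rewrite (gsign_split T sUD) (gsign_split U sTD) -oT -oU -(gsignC dTU).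
rewrite !fsetDDl (fsetUC U T); set D := S `\` _.
(* The right side contains the square of [gsign F U T], once from the commutation sign and once from
   the splitting; the left side receives the same square, which is 1. *)
rewrite -[LHS]mulr1 -(gsignK U T); set g := gsign F U T; set h := gsign F T U.
by ring.
Qed.
Lemma homogeneous_gmul a b x y : homogeneous a x -> homogeneous b y ->
  homogeneous (a (+) b) (gmul x y).
Proof.
move=> hx hy S oS; rewrite /gmul big_seq big1 // => T.
rewrite fpowersetE => sTS.
have [oT|/hx->] := eqVneq (odd #|` T|) a; last by rewrite mulr0 mul0r.
have [oU|/hy->] := eqVneq (odd #|` S `\` T|) b; last by rewrite mulr0.
by case/eqP: oS; rewrite -(cardfsID T S) oddD (fsetIidPr sTS) oT oU.
Qed.

Lemma in_G_gmul x y : in_G x -> in_G y -> in_G (gmul x y).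
Proof.
move=> [s hs] [t ht]; exists [seq A `|` B | A <- s, B <- t] => S nzS.
have [/hasP[T]|/hasPn no] :=
    boolP (has (fun T => (x T != 0) && (y (S `\` T) != 0)) (fpowerset S)).
  rewrite fpowersetE => sTS /andP[/hs Ts /ht St].
  by apply/allpairsP; exists (T, S `\` T); rewrite /= fsetUDl fsetDv fsetD0 (fsetUidPr _ _ sTS).
case/eqP: nzS; rewrite /gmul big_seq big1 // => T /no.
by rewrite negb_and !negbK => /orP[]/eqP->; rewrite ?mulr0 ?mul0r.
Qed.

Lemma gmul_basisl A y S :
  gmul (gbasis A) y S = if A `<=` S then gsign F A (S `\` A) * y (S `\` A) else 0.
Proof.
rewrite /gmul /gbasis; case: ifPn => sAS.
  rewrite (big_fsetD1 A) ?fpowersetE //= eqxx mulr1 big_seq big1 ?addr0 // => T.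
  by rewrite !inE => /andP[/negPf-> _]; rewrite mulr0 mul0r.
rewrite big_seq big1 // => T; rewrite fpowersetE.
by case: eqP => [->|_]; rewrite ?(negPf sAS) // mulr0 mul0r.
Qed.

Lemma gmul_basis A B : [disjoint A & B]%fset ->
  gmul (gbasis A) (gbasis B) = gscale (gsign F A B) (gbasis (A `|` B)).
Proof.
move=> dAB; apply: functional_extensionality => S; rewrite gmul_basisl /gscale /gbasis.
have [->|neqS] := eqVneq S (A `|` B).
  rewrite fsubsetUl fsetDUl fsetDv fset0U.
  by move: dAB; rewrite fdisjoint_sym => /fsetDidPl ->; rewrite eqxx.
case: ifP => sAS; rewrite ?mulr0 //; have [SA|_] := eqVneq (S `\` A) B; last by rewrite !mulr0.
by case/eqP: neqS; rewrite -SA fsetUDl fsetDv fsetD0 (fsetUidPr _ _ sAS).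
Qed.

Lemma gone_gmul y : gmul (gone F) y = y.
Proof.
apply: functional_extensionality => S.
have -> : gone F = gbasis fset0 by [].
by rewrite gmul_basisl fsub0set fsetD0 /gsign big_seq_fset0 expr0 mul1r.
Qed.

Lemma gmul_scalel a x y : gmul (gscale a x) y = gscale a (gmul x y).
Proof.
apply: functional_extensionality => S; rewrite /gmul /gscale mulr_sumr.
by apply: eq_bigr => T _; ring.
Qed.

Lemma gmul0l y : gmul (fun=> 0) y = fun=> 0.
Proof.
apply: functional_extensionality => S.
by apply: big1 => T _; rewrite mulr0 mul0r.
Qed.

Lemma gmul0r x : gmul x (fun=> 0) = fun=> 0.
Proof.
by apply: functional_extensionality => S; apply: big1 => T _; rewrite mulr0.
Qed.

Lemma fsetD_sub T S : T `<=` S -> S `\` (S `\` T) = T.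
Proof. by move=> sTS; rewrite fsetDDr fsetDv fset0U (fsetIidPr sTS). Qed.

(** Complementing [T] in [S] exchanges the factors, and [gsignC] gives no sign on the even [T] that
    support [x]; [y] is arbitrary. *)
Lemma gmul_evenC x y : homogeneous false x -> gmul x y = gmul y x.
Proof.
move=> hx; apply: functional_extensionality => S; rewrite /gmul.
have pS : perm_eq (enum_fset (fpowerset S)) [seq S `\` T | T <- enum_fset (fpowerset S)].
  apply: uniq_perm; first exact: fset_uniq.
    rewrite map_inj_in_uniq ?fset_uniq // => T U; rewrite !fpowersetE => sT sU eqTU.
    by rewrite -[T](fsetD_sub sT) eqTU fsetD_sub.
  move=> T; apply/idP/mapP => [|[U]]; rewrite fpowersetE.
    move=> sTS; exists (S `\` T); first by rewrite fpowersetE fsubsetDl.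
    by rewrite fsetD_sub.
  by move=> _ ->; rewrite fpowersetE fsubsetDl.
rewrite [RHS](perm_big _ pS) big_map big_seq [RHS]big_seq.
apply: eq_bigr => T; rewrite fpowersetE => sTS.
rewrite (fsetD_sub sTS).
have [oT|/hx->] := eqVneq (odd #|` T|) false; last by rewrite !(mulr0, mul0r).
have dT : [disjoint T & S `\` T]%fset.
  by apply/fdisjointP => t tT; rewrite in_fsetD tT.
have := gsignC dT; rewrite oT expr0 => eq1.
rewrite -[gsign F T _]mulr1 -(gsignK (S `\` T) T) mulrA eq1 mul1r; ring.
Qed.

Lemma gone_homogeneous : homogeneous false (gone F).
Proof. by move=> S; rewrite /gone; have [->|] := eqVneq S fset0; rewrite ?cardfs0. Qed.

Lemma gbasis_in_G A : in_G (gbasis A).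
Proof.
by exists [:: A] => S; rewrite inE /gbasis; have [|] := eqVneq S A; rewrite ?eqxx.
Qed.

Lemma in_G0P x : in_G0 x <-> in_G x /\ homogeneous false x.
Proof.
split=> -[fx hx]; split=> // S; first by rewrite eqbF_neg negbK; exact: hx.
by move=> oS; apply: hx; rewrite oS.
Qed.

Lemma in_G1P x : in_G1 x <-> in_G x /\ homogeneous true x.
Proof.
split=> -[fx hx]; split=> // S; first by rewrite eqb_id; exact: hx.
by move=> oS; apply: hx; rewrite eqb_id.
Qed.

Lemma in_G_sum (I : finType) (c : I -> F) (X : I -> gvec F) :
  (forall i, in_G (X i)) -> in_G (fun S => \sum_i c i * X i S).
Proof.
move=> GX.
have : forall r : seq I, in_G (fun S => \sum_(i <- r) c i * X i S).
  elim=> [|i r [t ht]]; first by exists [::] => S; rewrite big_nil eqxx.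
  have [s hs] := GX i; exists (s ++ t) => S; rewrite big_cons mem_cat.
  have [->|/hs->//] := eqVneq (X i S) 0; rewrite mulr0 add0r => /ht->.
  by rewrite orbT.
exact.
Qed.

Lemma homogeneous_sum b (I : finType) (c : I -> F) (X : I -> gvec F) :
  (forall i, c i = 0 \/ homogeneous b (X i)) ->
  homogeneous b (fun S => \sum_i c i * X i S).
Proof.
move=> hX S oS; apply: big1 => i _.
by case: (hX i) => [->|/(_ S oS)->]; rewrite ?mul0r ?mulr0.
Qed.

(** An odd basis vector anticommutes with a generator outside its support, so centrality gives 2c =
    0. *)
Lemma gbasis_odd_noncentral (charF0 : [pchar F] =i pred0) c A m :
  m \notin A -> odd #|` A| -> in_center (gscale c (gbasis A)) -> c = 0.
Proof.
move=> mA oA [_ /(_ _ (gbasis_in_G [fset m]))].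
have dA : [disjoint A & [fset m]]%fset.
  by rewrite fdisjointX1.
have dm : [disjoint [fset m] & A]%fset by rewrite fdisjoint_sym.
rewrite gmul_scalel gmul_scaler !gmul_basis // [[fset m] `|` A]fsetUC.
move/(congr1 (fun x => x (A `|` [fset m]))); rewrite /gscale /gbasis eqxx !mulr1.
have := gsignC dA; rewrite oA cardfs1 /= expr1; set g := gsign F A _.
set h := gsign F _ A => gh eq_gh.
have : c * 2%:R = 0.
  have -> : c * 2%:R = c * (g * g) - c * (g * h) by rewrite gsignK gh; ring.
  by rewrite !mulrA [c * g * h]mulrAC -eq_gh mulrAC subrr.
move/eqP; rewrite mulf_eq0 (pcharf0P F).1 // orbF; exact/eqP.
Qed.

End GrassmannAlgebra.

(** * Koszul signs of reordered products *)

Section Koszul.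
Variables (F : fieldType) (n : nat).
Implicit Types (e : 'I_n -> bool) (x : 'I_n -> gvec F) (l r : seq 'I_n).

Definition gprod x l : gvec F := \big[@gmul F/gone F]_(j <- l) x j.

Definition koszul_pair e (j u : 'I_n) : F := (-1) ^+ [&& e j, e u & (u < j)%N].

(** For [l] without repetition, the sign of the permutation that sorts its odd letters. *)
Fixpoint koszul e l : F :=
  if l is j :: l' then (\prod_(u <- l') koszul_pair e j u) * koszul e l' else 1.

Lemma koszul_sqr e l : koszul e l * koszul e l = 1.
Proof.
elim: l => [|j l IHl] /=; first by rewrite mulr1.
rewrite mulrACA IHl mulr1 -big_split big1 // => u _.
by rewrite /= -expr2 sqrr_sign.
Qed.

(** Only the factor of the pair [i], [j] changes in the Koszul sign, and it compensates the sign of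
    [gmul_lcomm]: as [i != j], exactly one of the two orders is decreasing. *)
Lemma gprod_swap e x j i l : (forall k, homogeneous (e k) (x k)) -> i != j ->
  gscale (koszul e [:: j, i & l]) (gprod x [:: j, i & l]) =
  gscale (koszul e [:: i, j & l]) (gprod x [:: i, j & l]).
Proof.
move=> hx neq_ij; rewrite /gprod !big_cons (gmul_lcomm _ (hx j) (hx i)) gscaleA.
congr (gscale _ _) => /=; rewrite !big_cons.
suff -> : koszul_pair e i j = koszul_pair e j i * (-1) ^+ (e j && e i) by ring.
rewrite /koszul_pair -signr_addb; congr (_ ^+ _).
case: (e j); case: (e i) => //=.
by move: neq_ij; rewrite -(inj_eq val_inj) /=; case: ltngtP.
Qed.

Lemma gprod_perm_cons e x j l r : perm_eq l r ->
  gscale (koszul e l) (gprod x l) = gscale (koszul e r) (gprod x r) ->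
  gscale (koszul e (j :: l)) (gprod x (j :: l)) =
  gscale (koszul e (j :: r)) (gprod x (j :: r)).
Proof.
move=> lr eq_lr; rewrite /gprod !big_cons /= (perm_big _ lr) /=.
by rewrite -!gscaleA -!gmul_scaler; congr (gmul _ (gscale _ _)).
Qed.

Lemma gprod_rotate e x j l r : (forall k, homogeneous (e k) (x k)) ->
  j \notin l ->
  gscale (koszul e (j :: l ++ r)) (gprod x (j :: l ++ r)) =
  gscale (koszul e (l ++ j :: r)) (gprod x (l ++ j :: r)).
Proof.
move=> hx; elim: l => [//|i l IHl] /=; rewrite inE negb_or => /andP[neq_ji jl].
rewrite gprod_swap // 1?eq_sym //; apply: gprod_perm_cons (IHl jl).
by rewrite -cat1s perm_catCA.
Qed.

(** Induction on [l]: its head is located in [r] and brought to the front by [gprod_rotate]. *)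
Lemma gprod_perm e x l r : (forall k, homogeneous (e k) (x k)) ->
  uniq l -> perm_eq l r ->
  gscale (koszul e l) (gprod x l) = gscale (koszul e r) (gprod x r).
Proof.
move=> hx; elim: l r => [|j l IHl] r /=.
  by rewrite perm_sym => _ /perm_nilP->.
case/andP=> jl uniq_l lr.
have : j \in r by rewrite -(perm_mem lr) mem_head.
move=> jr; move: jr lr => /splitPr[r1 r2] lr.
have lr12 : perm_eq l (r1 ++ r2).
  by rewrite -(perm_cons j) (perm_trans lr) // -cat1s perm_catCA.
rewrite -gprod_rotate //; first exact: gprod_perm_cons (IHl _ uniq_l lr12).
by move: jl; rewrite (perm_mem lr12) mem_cat negb_or => /andP[].
Qed.

Lemma gprod_in_G x l : (forall j, in_G (x j)) -> in_G (gprod x l).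
Proof.
by move=> Gx; rewrite /gprod; elim/big_rec: _ => [|j y _]; [exact: gbasis_in_G | exact: in_G_gmul].
Qed.

Lemma gprod_homogeneous e x l : (forall j, homogeneous (e j) (x j)) ->
  homogeneous (odd (\sum_(j <- l) e j)) (gprod x l).
Proof.
move=> hx; rewrite /gprod; elim: l => [|j l IHl].
  by rewrite !big_nil; exact: gone_homogeneous.
by rewrite !big_cons oddD oddb; exact: homogeneous_gmul.
Qed.

Lemma gprod_eq0 x l j : j \in l -> x j = (fun=> 0) -> gprod x l = fun=> 0.
Proof.
rewrite /gprod => jl xj0; elim: l jl => [//|i l IHl]; rewrite inE big_cons.
by case/predU1P => [<-|/IHl->]; rewrite ?xj0 ?gmul0l ?gmul0r.
Qed.

Definition odd_support e l : {fset nat} :=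
  foldr (fun j A => if e j then (j : nat) |` A else A) fset0 l.

Lemma odd_supportP e l (k : nat) :
  reflect (exists2 j, j \in l & e j /\ k = j) (k \in odd_support e l).
Proof.
elim: l => [|i l IHl] /=; first by rewrite inE; constructor => -[].
case: ifPn => ei; first rewrite in_fset1U.
  apply: (iffP predU1P) => [[->|/IHl[j jl ej]]|[j]].
  - by exists i; rewrite ?mem_head.
  - by exists j; rewrite // inE jl orbT.
  rewrite inE => /predU1P[->|jl] [ej kj]; first by left.
  by right; apply/IHl; exists j.
apply: (iffP IHl) => -[j jl [ej ->]].
  by exists j; rewrite // inE jl orbT.
move: jl; rewrite inE => /predU1P[ji|jl]; last by exists j.
by rewrite -ji ej in ei.
Qed.

(** The substitution y_j = 1, z_j = e_j along the word [e]. *)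
Definition generic_odd e (j : 'I_n) : gvec F :=
  if e j then gbasis F [fset (j : nat)] else gone F.

(** Each letter is smaller than all those after it, so multiplying by it on the left creates no
    sign. *)
Lemma gprod_generic e l : pairwise (relpre val ltn) l ->
  gprod (generic_odd e) l = gbasis F (odd_support e l).
Proof.
rewrite /gprod; elim: l => [|j l IHl]; first by rewrite big_nil.
rewrite big_cons /= => /andP[/allP lt_jl /IHl->].
rewrite /generic_odd; case: ifP => ej; last exact: gone_gmul.
have jl u : u \in odd_support e l -> (j < u)%N.
  by case/odd_supportP => i /lt_jl lt_ji [_ ->].
rewrite gmul_basis; last first.
  by rewrite fdisjoint1X; apply/negP => /jl; rewrite ltnn.
rewrite /gsign big_seq_fset1 big_seq big1 ?expr0 ?gscale1 // => u /jl.
by rewrite ltnNge => /negPf; case: ltngtP.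
Qed.

(** In an increasing list the entries after [k] are those above [k], which turns the recursion into
    a product over pairs of positions. *)
Lemma koszul_map e (s : 'I_n -> 'I_n) l : pairwise (relpre val ltn) l ->
  koszul e [seq s k | k <- l] =
  \prod_(k <- l) \prod_(m <- l | (k < m)%N) koszul_pair e (s k) (s m).
Proof.
elim: l => [|j l IHl]; first by rewrite big_nil.
move=> /= /andP[/allP lt_jl pl]; rewrite big_map IHl // big_cons; congr (_ * _).
  rewrite big_cons ltnn big_seq_cond [RHS]big_seq_cond.
  by apply: eq_bigl => u; case: (boolP (u \in l)) => // /lt_jl /= ->.
rewrite big_seq [RHS]big_seq; apply: eq_bigr => k /lt_jl /= lt_jk.
by rewrite big_cons ltnNge (ltnW lt_jk).
Qed.

End Koszul.

(** * Inversion signs on marked positions *)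

Section InversionSign.
Variables (F : fieldType) (n : nat).
Implicit Types (e : 'I_n -> bool) (s t : 'S_n).

(** With every position marked this is the signature of [s]; in general, that of the permutation
    sorting the images of the marked positions. *)
Definition inv_sign e s : F :=
  \prod_(p : 'I_n * 'I_n | [&& e p.1, e p.2 & (p.1 < p.2)%N])
     (-1) ^+ (s p.2 < s p.1)%N.

Lemma eq_inv_sign e e' s : e =1 e' -> inv_sign e s = inv_sign e' s.
Proof. by move=> ee'; apply: eq_bigl => p; rewrite !ee'. Qed.

Lemma inv_sign1 e : inv_sign e 1%g = 1.
Proof.
apply: big1 => p /and3P[_ _ lt12]; rewrite !perm1.
by rewrite ltnNge (ltnW lt12).
Qed.

(* The pairs whose order is reversed by [s] are exactly those on which
   reindexing along [s] changes the sign of the factor of [t]. *)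
Lemma inv_signM e s t :
  inv_sign e (s * t)%g = inv_sign e s * inv_sign (e \o s^-1%g) t.
Proof.
have swapK : involutive (fun q : 'I_n * 'I_n => (q.2, q.1)) by case.
pose h (q : 'I_n * 'I_n) : F := (-1) ^+ (t (s q.2) < t (s q.1))%N.
pose up (q : 'I_n * 'I_n) := (s q.1 < s q.2)%N.
have sinj : injective (fun q : 'I_n * 'I_n => (s q.1, s q.2)).
  by case=> [a b] [c d] /= [/perm_inj-> /perm_inj->].
rewrite {3}/inv_sign (reindex_inj sinj) /=.
rewrite (eq_bigl (fun q => [&& e q.1, e q.2 & up q])); last first.
  by move=> q; rewrite !permK.
rewrite (bigID (fun q : 'I_n * 'I_n => (q.1 < q.2)%N)) /=.
rewrite [X in _ * (_ * X)](reindex_inj (inv_inj swapK)) /=.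
rewrite {1}/inv_sign (bigID up) /=.
have -> : inv_sign e s = \prod_(q : 'I_n * 'I_n |
    [&& e q.1, e q.2 & (q.1 < q.2)%N] && ~~ up q) -1.
  rewrite /inv_sign (bigID up) /= big1 ?mul1r => [|q /andP[_]]; last first.
    by rewrite /up => lt12; rewrite ltnNge (ltnW lt12).
  apply: eq_bigr => q /andP[/and3P[_ _ lt12]].
  rewrite /up -leqNgt leq_eqVlt (inj_eq val_inj) (inj_eq perm_inj).
  by rewrite -(inj_eq val_inj) (gtn_eqF lt12) /= => ->.
rewrite [RHS]mulrCA; congr (_ * _).
  apply: eq_big => q; last by rewrite !permM.
  by rewrite /up -!andbA; do 2!congr (_ && _); rewrite andbC.
rewrite [X in _ = _ * X](eq_bigl (fun q : 'I_n * 'I_n =>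
  [&& e q.1, e q.2 & (q.1 < q.2)%N] && ~~ up q)); last first.
  move=> [a b]; rewrite /up /=; case: (e a); case: (e b) => //=.
  have [->|neq_ab] := eqVneq a b; first by rewrite !ltnn.
  have nat_neq (c d : 'I_n) : c != d -> ((c : nat) == d) = false.
    by rewrite -(inj_eq val_inj) => /negPf.
  have := nat_neq _ _ neq_ab; rewrite -(inj_eq (@perm_inj _ s)) in neq_ab.
  move/nat_neq: neq_ab.
  by case: (ltngtP a b); case: (ltngtP (s a) (s b)).
rewrite -big_split /=; apply: eq_bigr => q /andP[/and3P[_ _ lt12] _].
rewrite !permM.
have: t (s q.2) != t (s q.1).
  by rewrite !(inj_eq perm_inj) -(inj_eq val_inj) (gtn_eqF lt12).
rewrite -(inj_eq val_inj) /=.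
by case: ltngtP => //= _ _; rewrite ?(expr1, expr0, mulr1, mulrNN).
Qed.

(** [inv_signM] leaves a sign of [t] and one of its inverse; since [s] preserves the transported
    marking, these combine into the sign of the identity. *)
Lemma inv_sign_conj e s t : (e \o t^-1%g) \o s =1 e \o t^-1%g ->
  inv_sign e (t * s * t^-1)%g = inv_sign (e \o t^-1%g) s.
Proof.
move=> fix_s; rewrite !inv_signM.
rewrite (@eq_inv_sign (e \o (t * s)^-1%g) (e \o t^-1%g)); last first.
  move=> k; rewrite /= invMg permM.
  by have /= := fix_s (s^-1%g k); rewrite permKV.
by rewrite mulrAC -inv_signM mulgV inv_sign1 mul1r.
Qed.

End InversionSign.

(** * Traces and dimensions along nested subspaces *)

Lemma natr_inj_pchar0 (F : fieldType) (charF0 : [pchar F] =i pred0) :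
  injective (fun m => m%:R : F).
Proof.
have le_inj m k : (m <= k)%N -> m%:R = k%:R :> F -> m = k.
  move=> le_mk /eqP; rewrite eq_sym -subr_eq0 -natrB //.
  by rewrite (pcharf0P F).1 // subn_eq0 => le_km; apply/eqP; rewrite eqn_leq le_mk.
move=> m k; have [/le_inj//|/ltnW/le_inj eq_km /esym/eq_km//] := leqP m k.
Qed.

Section Trace.
Variables (F : fieldType) (V : vectType F).
Implicit Types (U W : {vspace V}) (f : {linear V -> V}).

Definition optrace (h : V -> V) : F :=
  \sum_(m < \dim (fullv : {vspace V}))
     coord (vbasis fullv) m (h (vbasis fullv)`_m).

Definition subtrace U (h : V -> V) : F :=
  \sum_(j < \dim U) coord (vbasis U) j (h (vbasis U)`_j).

(** A rank-one map v -> l(v) w has trace l(w); traces on subspaces will be brought to this form. *)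
Lemma optrace_sum (I : finType) (P : pred I) (l : I -> {scalar V})
    (w : I -> V) :
  optrace (fun v => \sum_(i | P i) l i v *: w i) = \sum_(i | P i) l i (w i).
Proof.
rewrite /optrace (eq_bigr (fun m : 'I__ => \sum_(i | P i) l i (vbasis fullv)`_m *
   coord (vbasis fullv) m (w i))); last first.
  by move=> m _; rewrite linear_sum /=; apply: eq_bigr => i _; rewrite linearZ.
rewrite exchange_big /=; apply: eq_bigr => i _.
rewrite [in RHS](coord_vbasis (memvf (w i))) linear_sum /=.
by apply: eq_bigr => m _; rewrite linearZ /= mulrC.
Qed.

Lemma subtrace_id U : subtrace U id = (\dim U)%:R.
Proof.
rewrite /subtrace (eq_bigr (fun=> 1)) => [|j _].
  by rewrite sumr_const card_ord.
by rewrite coord_free ?eqxx // (basis_free (vbasisP U)).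
Qed.

(* For [f] stable on [U <= W], with [d] spanning a complement of [U] in [W]
   dual to the functionals [l]. *)
Lemma subtrace_split (I : finType) (P : pred I) U W (l : I -> {scalar V})
    (d : I -> V) (f : {linear V -> V}) :
    (U <= W)%VS -> (forall i, P i -> d i \in W) ->
    (forall v i, P i -> v \in U -> l i v = 0) ->
    (forall v, v \in W -> v - \sum_(i | P i) l i v *: d i \in U) ->
    (forall v, v \in W -> f v \in W) -> (forall v, v \in U -> f v \in U) ->
  subtrace W f = subtrace U f + \sum_(i | P i) l i (f (d i)).
Proof.
move=> sUW dW lU projU fW fU.
(* [q] maps the whole space into [U] and fixes [U], so the trace of [f] on [U] is the full trace of
   [f] after [q]. For [W], [projv W] plays the same role. *)
pose q v := projv W v - \sum_(i | P i) l i (projv W v) *: d i.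
have lin_q : linear q.
  move=> a u v; rewrite /q linearP scalerBr scaler_sumr addrACA -opprD.
  congr (_ - _); rewrite -big_split; apply: eq_bigr => i _.
  by rewrite linearP scalerDl scalerA.
pose qL : {linear V -> V} := HB.pack q (GRing.isLinear.Build _ _ _ _ q lin_q).
have expand (X : {vspace V}) v : v \in X ->
    f v = \sum_(j < \dim X) coord (vbasis X) j v *: f (vbasis X)`_j.
  move=> vX; rewrite {1}(coord_vbasis vX) linear_sum.
  by apply: eq_bigr => j _; rewrite linearZ.
have vb (X : {vspace V}) (j : 'I_(\dim X)) : (vbasis X)`_j \in X.
  by rewrite vbasis_mem // mem_nth // size_tuple.
have -> : subtrace W f = optrace (fun v => f (projv W v)).
  pose c (j : 'I_(\dim W)) : {scalar V} := (coord (vbasis W) j \o projv W)%FUN.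
  transitivity (optrace (fun v => \sum_j c j v *: f (vbasis W)`_j)).
    rewrite optrace_sum; apply: eq_bigr => j _ /=.
    by rewrite projv_id // fW // vb.
  by apply: eq_bigr => m _; rewrite -expand ?memv_proj.
have -> : subtrace U f = optrace (fun v => f (q v)).
  pose c (j : 'I_(\dim U)) : {scalar V} := (coord (vbasis U) j \o qL)%FUN.
  transitivity (optrace (fun v => \sum_j c j v *: f (vbasis U)`_j)).
    rewrite optrace_sum; apply: eq_bigr => j _ /=; congr (coord _ _ _).
    have fU' := fU _ (vb U j).
    rewrite /q projv_id ?(subvP sUW) // big1 ?subr0 // => i Pi.
    by rewrite (lU _ _ Pi fU') scale0r.
  by apply: eq_bigr => m _; rewrite -expand // projU // memv_proj.
(* The two composites differ by the sum of the rank-one maps sending v to l_i(projv W v) f(d_i). *)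
pose c i : {scalar V} := (l i \o projv W)%FUN.
rewrite (eq_bigr (fun i => c i (f (d i)))) => [|i Pi]; last first.
  by rewrite /= projv_id // fW // dW.
rewrite -optrace_sum -big_split; apply: eq_bigr => m _ /=.
rewrite -linearD; congr (coord _ _ _); rewrite /q linearB linear_sum /=.
rewrite (eq_bigr (fun i => l i (projv W (vbasis fullv)`_m) *: f (d i))).
  by rewrite subrK.
by move=> i _; rewrite linearZ.
Qed.

(** The identity in [subtrace_split] has the dimensions as traces; characteristic zero lifts the
    equality from [F] to the naturals. *)
Lemma dim_split (charF0 : [pchar F] =i pred0) (I : finType) (P : pred I) U W
    (l : I -> {scalar V}) (d : I -> V) :
    (U <= W)%VS -> (forall i, P i -> d i \in W) ->
    (forall v i, P i -> v \in U -> l i v = 0) ->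
    (forall v, v \in W -> v - \sum_(i | P i) l i v *: d i \in U) ->
    (forall i, P i -> l i (d i) = 1) ->
  \dim W = (\dim U + #|P|)%N.
Proof.
move=> sUW dW lU projU ld.
have := subtrace_split (f := idfun) sUW dW lU projU (fun _ => id) (fun _ => id).
rewrite !subtrace_id (eq_bigr (fun=> 1)) // sumr_const -natrD.
exact: natr_inj_pchar0.
Qed.

End Trace.

(** * Evaluation through the functionals L_eps *)

Section ReducedForm.
Variables (F : fieldType) (n : nat).
Implicit Types (eps : {ffun 'I_n -> bool}) (f : Pn F n) (g x : wr n).

Lemma map_perm1 (r : seq 'I_n) : [seq (1%g : 'S_n) k | k <- r] = r.
Proof. by rewrite -[RHS]map_id; apply: eq_map => k; rewrite perm1. Qed.

Lemma enum_ord_pairwise : pairwise (relpre val ltn) (enum 'I_n).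
Proof.
rewrite -(pairwise_map (fun k : 'I_n => k : nat)) val_enum_ord.
by rewrite -(sorted_pairwise ltn_trans) iota_ltn_sorted.
Qed.

(** Position [k] holds the letter [s k], so a marking [e] of letters becomes the marking [e \o s] of
    positions. *)
Lemma koszul_enum (e : 'I_n -> bool) (s : 'S_n) :
  koszul F e [seq s k | k <- enum 'I_n] = inv_sign F (e \o s) s.
Proof.
rewrite koszul_map; last exact: enum_ord_pairwise.
rewrite big_enum /= (eq_bigr (fun k : 'I_n =>
    \prod_(m < n | (k < m)%N) koszul_pair F e (s k) (s m))); last first.
  by move=> k _; rewrite big_enum_cond.
rewrite pair_big_dep /= /inv_sign big_mkcond [RHS]big_mkcond.
apply: eq_bigr => -[k m] _; rewrite /koszul_pair /=.
by case: (e (s k)); case: (e (s m)); case: (k < m)%N.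
Qed.

Definition weight eps : nat := \sum_(j < n) eps j.

(** The functional L_eps: [eps] marks letters while [inv_sign] takes marked positions, whence the
    composition with [s]. *)
Definition coefL eps f : F :=
  \sum_(s : 'S_n) inv_sign F (eps \o s) s * f (eps, s).

Lemma coefL_scalar eps : scalar (coefL eps).
Proof.
move=> a u v; rewrite /coefL mulr_sumr -big_split; apply: eq_bigr => s _ /=.
by rewrite !ffunE /= mulrDr mulrCA.
Qed.

HB.instance Definition _ eps :=
  GRing.isLinear.Build F (Pn F n) F *%R (coefL eps) (coefL_scalar eps).

Lemma eval_mon_gprod (m : mon_index n) (ya za : 'I_n -> gvec F) :
  eval_mon m ya za = gprod (gvar m.1 ya za) [seq m.2 k | k <- enum 'I_n].
Proof. by rewrite /gprod big_map enumT /eval_mon; unlock index_enum. Qed.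

Lemma gvar_homogeneous eps (ya za : 'I_n -> gvec F) :
  graded_assignment ya za -> forall j, homogeneous (eps j) (gvar eps ya za j).
Proof.
case=> hy hz j; rewrite /gvar; case: (eps j); first by have [] := (in_G1P _).1 (hz j).
by have [] := (in_G0P _).1 (hy j).
Qed.

Lemma gvar_in_G eps (ya za : 'I_n -> gvec F) j :
  graded_assignment ya za -> in_G (gvar eps ya za j).
Proof. by case=> hy hz; rewrite /gvar; case: (eps j); [case: (hz j) | case: (hy j)]. Qed.

(** [gprod_perm] relates the word of [s] to the sorted word, whose sign is 1; the remaining sign is
    its own inverse. *)
Lemma eval_mon_sign eps (s : 'S_n) (ya za : 'I_n -> gvec F) :
  graded_assignment ya za ->
  eval_mon (eps, s) ya za =
    gscale (inv_sign F (eps \o s) s) (eval_mon (eps, 1%g) ya za).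
Proof.
move=> ga; rewrite !eval_mon_gprod /=.
have inj_s : uniq [seq s k | k <- enum 'I_n].
  by rewrite (map_inj_uniq (@perm_inj _ s)) enum_uniq.
have pe : perm_eq [seq s k | k <- enum 'I_n] (enum 'I_n).
  apply: uniq_perm => //; first exact: enum_uniq.
  move=> j; rewrite mem_enum inE; apply/mapP; exists (s^-1%g j).
    by rewrite mem_enum.
  by rewrite permKV.
have := gprod_perm (gvar_homogeneous (eps := eps) ga) inj_s pe.
rewrite koszul_enum -[X in koszul F _ X]map_perm1 koszul_enum inv_sign1 gscale1 map_perm1 => <-.
by rewrite gscaleA -koszul_enum koszul_sqr gscale1.
Qed.

Lemma eval_polyE f (ya za : 'I_n -> gvec F) : graded_assignment ya za ->
  eval_poly f ya za =
    fun S => \sum_eps coefL eps f * eval_mon (eps, 1%g) ya za S.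
Proof.
move=> ga; apply: functional_extensionality => S; rewrite /eval_poly.
transitivity (\sum_eps \sum_(s : 'S_n) f (eps, s) * eval_mon (eps, s) ya za S).
  by rewrite pair_big; apply: eq_bigr => -[].
apply: eq_bigr => eps _; rewrite /coefL mulr_suml; apply: eq_bigr => s _.
by rewrite eval_mon_sign // /gscale mulrA [f _ * _]mulrC.
Qed.

(** Variables that do not occur in the word [eps] are sent to 0, so that every other word
    vanishes. *)
Definition test_even eps (j : 'I_n) : gvec F := if eps j then fun=> 0 else gone F.
Definition test_odd eps (j : 'I_n) : gvec F :=
  if eps j then gbasis F [fset (j : nat)]%fset else fun=> 0.

Lemma test_graded eps : graded_assignment (test_even eps) (test_odd eps).
Proof.
have G0 : in_G (fun _ => 0 : F) by exists [::] => S; rewrite eqxx.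
split=> j; rewrite /test_even /test_odd.
  apply/in_G0P; case: (eps j); split=> //; first exact: gbasis_in_G.
  exact: gone_homogeneous.
apply/in_G1P; case: (eps j); split=> //; first exact: gbasis_in_G.
move=> S; rewrite /gbasis; have [->|//] := eqVneq S [fset (j : nat)]%fset.
by rewrite cardfs1.
Qed.

Lemma gprod_enum_generic eps :
  gprod (generic_odd F eps) (enum 'I_n) = gbasis F (odd_support eps (enum 'I_n)).
Proof. exact: gprod_generic enum_ord_pairwise. Qed.

Lemma eval_poly_test eps f :
  eval_poly f (test_even eps) (test_odd eps) =
    gscale (coefL eps f) (gbasis F (odd_support eps (enum 'I_n))).
Proof.
rewrite eval_polyE; last exact: test_graded.
apply: functional_extensionality => S.
rewrite (bigD1 eps) //= big1 ?addr0 => [|eps' neq_eps].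
  rewrite eval_mon_gprod /= map_perm1 -gprod_enum_generic; congr (_ * gprod _ _ _).
  by apply: functional_extensionality => j; rewrite /gvar /test_even /test_odd /generic_odd; case: (eps j).
have /existsP[j neq_j] : [exists j, eps' j != eps j].
  rewrite -negb_forall; apply: contra neq_eps => /forallP eq_eps.
  by apply/eqP/ffunP => j; apply/eqP.
rewrite eval_mon_gprod /= map_perm1 (gprod_eq0 (j := j)) ?mulr0 ?mem_enum //.
rewrite /gvar /test_even /test_odd.
by case: (eps' j) neq_j; case: (eps j).
Qed.

(** The generic product is a nonzero basis vector, homogeneous of the parity of [weight eps]; this
    forces the parity of its support. *)
Lemma odd_support_odd eps : odd #|` odd_support eps (enum 'I_n)| = odd (weight eps).
Proof.
have hom j : homogeneous (eps j) (generic_odd F eps j).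
  rewrite /generic_odd; case: (eps j); last exact: gone_homogeneous.
  move=> S; rewrite /gbasis; have [->|//] := eqVneq S [fset (j : nat)]%fset.
  by rewrite cardfs1.
have := gprod_homogeneous (l := enum 'I_n) hom; rewrite gprod_enum_generic.
move/(_ (odd_support eps (enum 'I_n))); rewrite /gbasis eqxx big_enum /=.
by case: eqP => // _ /(_ isT)/eqP; rewrite oner_eq0.
Qed.

Lemma identity_polyP f : identity_poly f <-> forall eps, coefL eps f = 0.
Proof.
split=> [id_f eps | f0 ya za ga].
  have := id_f _ _ (test_graded eps); rewrite eval_poly_test.
  move/(congr1 (fun y => y (odd_support eps (enum 'I_n)))).
  by rewrite /gscale /gbasis eqxx mulr1.
rewrite eval_polyE //; apply: functional_extensionality => S.
by apply: big1 => eps _; rewrite f0 mul0r.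
Qed.

Lemma central_polyP (charF0 : [pchar F] =i pred0) f :
  central_poly f <-> forall eps, odd (weight eps) -> coefL eps f = 0.
Proof.
split=> [cen_f eps odd_eps | f0 ya za ga].
  have := cen_f _ _ (test_graded eps); rewrite eval_poly_test.
  (* [odd_support] only contains indices below [n], so the generator of index [n] lies outside
     it. *)
  apply: (gbasis_odd_noncentral charF0 (m := n)); last by rewrite odd_support_odd.
  apply/odd_supportP => -[j _ [_ nj]].
  by have := ltn_ord j; rewrite -nj ltnn.
rewrite eval_polyE //; split.
  apply: in_G_sum => eps; rewrite eval_mon_gprod.
  by apply: gprod_in_G => j; exact: gvar_in_G.
(* Words of odd weight contribute nothing, so the value is even and commutes with every [y]. *)
move=> y _; apply: gmul_evenC; apply: homogeneous_sum => eps.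
have [/f0|even_eps] := boolP (odd (weight eps)); [by left | right].
rewrite eval_mon_gprod /=.
have := gprod_homogeneous (l := enum 'I_n) (gvar_homogeneous (eps := eps) ga).
rewrite big_enum /= -/(weight eps) (negPf even_eps).
by rewrite map_perm1.
Qed.

End ReducedForm.

(** * The wreath product action on the functionals *)

Section Characters.
Variables (F : fieldType) (n : nat).
Implicit Types (eps : {ffun 'I_n -> bool}) (f : Pn F n) (g x : wr n).
Implicit Types (P Q : pred {ffun 'I_n -> bool}).

Definition coefL_map P f : {ffun {ffun 'I_n -> bool} -> F^o} :=
  [ffun eps => if P eps then coefL eps f else 0].

Lemma coefL_map_linear P : linear (coefL_map P).
Proof.
move=> a u v; apply/ffunP => eps; rewrite !ffunE /=.
by case: (P eps); rewrite ?linearP // scaler0 addr0.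
Qed.

HB.instance Definition _ P :=
  GRing.isLinear.Build F (Pn F n) {ffun {ffun 'I_n -> bool} -> F^o} *:%R
    (coefL_map P) (coefL_map_linear P).

Definition coefL_ker P : {vspace Pn F n} := lker (linfun (coefL_map P)).

Lemma coefL_kerP P f :
  f \in coefL_ker P <-> (forall eps, P eps -> coefL eps f = 0).
Proof.
rewrite memv_ker lfunE /=; split=> [/eqP/ffunP f0 eps Peps | f0].
  by have := f0 eps; rewrite !ffunE Peps.
by apply/eqP/ffunP => eps; rewrite !ffunE; case: ifP => // /f0.
Qed.

Lemma coefL_ker0 : coefL_ker pred0 = fullv.
Proof. by apply/vspaceP => f; rewrite memvf; apply/coefL_kerP. Qed.

Definition mon1 eps : Pn F n := [ffun m => (m == (eps, 1%g))%:R].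

Lemma coefL_mon1 eps eps' : coefL eps (mon1 eps') = (eps == eps')%:R.
Proof.
rewrite /coefL (bigD1 1%g) //= big1 ?addr0 => [|s neq1].
  by rewrite inv_sign1 mul1r ffunE xpair_eqE eqxx andbT.
by rewrite ffunE xpair_eqE (negPf neq1) andbF mulr0.
Qed.

Definition eps_act eps (s : 'S_n) : {ffun 'I_n -> bool} := [ffun j => eps (s j)].

Definition signed_fix g eps : F :=
  if eps_act eps g.2 == eps
  then (\prod_(j < n | eps j) sgnb F (g.1 j)) * inv_sign F eps g.2 else 0.

Lemma wact_linear g : linear (@wact F n g).
Proof.
move=> a u v; apply/ffunP => m; rewrite [LHS]ffunE [RHS]ffunE !ffunE /=.
have evalP w : (a *: u + v) w = a * u w + v w by rewrite !ffunE.
by rewrite evalP mulrDr mulrCA.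
Qed.

HB.instance Definition _ g :=
  GRing.isLinear.Build F (Pn F n) (Pn F n) *:%R (@wact F n g) (wact_linear g).

(** Reindexing by right multiplication with [g.2] undoes the permutation in [wact]; [inv_signM] then
    separates a sign independent of the summation index. *)
Lemma coefL_wact eps g f :
  coefL eps (wact g f) =
    (\prod_(j < n | eps j) sgnb F (g.1 j)) * inv_sign F (eps_act eps g.2) g.2
    * coefL (eps_act eps g.2) f.
Proof.
rewrite {1}/coefL (reindex_inj (mulIg g.2)) /= /coefL mulr_sumr.
apply: eq_bigr => s _; rewrite ffunE /= mulgK inv_signM.
have -> : \prod_(j < n | eps j) sgnb F (g.1 j) =
    \prod_(j < n | eps_act eps g.2 j) sgnb F (g.1 (g.2 j)).
  rewrite (reindex_inj (@perm_inj _ g.2)) /=.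
  by apply: eq_bigl => j; rewrite ffunE.
rewrite (@eq_inv_sign F n (eps \o (s * g.2)%g) (eps_act eps g.2 \o s)); last first.
  by move=> k; rewrite /= ffunE permM.
rewrite (@eq_inv_sign F n ((eps \o (s * g.2)%g) \o s^-1%g) (eps_act eps g.2)); last first.
  by move=> k; rewrite /= ffunE permM permKV.
rewrite -/(eps_act eps g.2); ring.
Qed.

Lemma coefL_wact_mon1 eps g : coefL eps (wact g (mon1 eps)) = signed_fix g eps.
Proof.
rewrite coefL_wact coefL_mon1 /signed_fix; case: eqP => [->|_].
  by rewrite mulr1.
by rewrite mulr0.
Qed.

Lemma weight_act eps (s : 'S_n) : weight (eps_act eps s) = weight eps.
Proof.
rewrite /weight [RHS](reindex_inj (@perm_inj _ s)).
by apply: eq_bigr => j _; rewrite ffunE.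
Qed.

Lemma wact_coefL_ker P g f : (forall eps, P eps -> P (eps_act eps g.2)) ->
  f \in coefL_ker P -> wact g f \in coefL_ker P.
Proof.
move=> Pg /coefL_kerP f0; apply/coefL_kerP => eps /Pg/f0.
by rewrite coefL_wact => ->; rewrite mulr0.
Qed.

(** * Quotients of nested kernels *)

Section Split.
Variables P Q : pred {ffun 'I_n -> bool}.
Hypothesis disjPQ : forall eps, P eps -> ~~ Q eps.

Let ker_sub : (coefL_ker (predU Q P) <= coefL_ker Q)%VS.
Proof.
apply/subvP => f /coefL_kerP f0; apply/coefL_kerP => eps Qeps.
by apply: f0; rewrite /= Qeps.
Qed.

Let mon1_mem eps : P eps -> mon1 eps \in coefL_ker Q.
Proof.
move=> Peps; apply/coefL_kerP => eps' Qeps'; rewrite coefL_mon1.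
by case: eqP Qeps' => // ->; rewrite (negPf (disjPQ Peps)).
Qed.

Let coefL_vanish f eps : P eps -> f \in coefL_ker (predU Q P) -> coefL eps f = 0.
Proof. by move=> Peps /coefL_kerP; apply; rewrite /= Peps orbT. Qed.

(** Subtracting the ordered monomials of [P] cancels the functionals of [P] by duality, and leaves
    those of [Q] at 0 because [P] and [Q] are disjoint. *)
Let coefL_proj f : f \in coefL_ker Q ->
  f - \sum_(eps | P eps) coefL eps f *: mon1 eps \in coefL_ker (predU Q P).
Proof.
move/coefL_kerP => f0; apply/coefL_kerP => eps QPeps.
rewrite linearB linear_sum /=.
under eq_bigr do rewrite linearZ /= coefL_mon1.
have [Peps|nPeps] := boolP (P eps).
  rewrite (bigD1 eps) //= eqxx mulr1 big1 ?addr0 ?subrr // => eps' /andP[_].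
  by rewrite eq_sym => /negPf->; rewrite mulr0.
move: QPeps; rewrite /= (negPf nPeps) orbF => Qeps.
rewrite f0 // big1 ?subrr // => eps' Peps'; case: eqP => [eq_eps|_].
  by rewrite eq_eps Peps' in nPeps.
by rewrite mulr0.
Qed.

(** The ordered monomials of the words in [P] represent a basis of the quotient, and [signed_fix]
    gives the diagonal entries of [g] there. *)
Lemma trace_split g : (forall eps, P eps -> P (eps_act eps g.2)) ->
    (forall eps, Q eps -> Q (eps_act eps g.2)) ->
  trace_on (coefL_ker Q) g - trace_on (coefL_ker (predU Q P)) g =
    \sum_(eps | P eps) signed_fix g eps.
Proof.
move=> Pg Qg.
pose l eps : {scalar Pn F n} := @coefL F n eps.
have := subtrace_split (P := P) (l := l) (d := mon1) (f := @wact F n g)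
  ker_sub mon1_mem (fun v i Pi => coefL_vanish Pi) coefL_proj.
rewrite /subtrace /trace_on => ->.
- by rewrite addrC addKr; apply: eq_bigr => eps _; rewrite -coefL_wact_mon1.
- by move=> f; apply: wact_coefL_ker.
- move=> f; apply: wact_coefL_ker => eps /= /orP[/Qg->//|/Pg->].
  by rewrite orbT.
Qed.

Lemma coefL_ker_dim (charF0 : [pchar F] =i pred0) :
  (\dim (coefL_ker Q) - \dim (coefL_ker (predU Q P)))%N = #|P|.
Proof.
pose l eps : {scalar Pn F n} := @coefL F n eps.
rewrite (dim_split charF0 (P := P) (l := l) (d := mon1) ker_sub mon1_mem
  (fun v i Pi => coefL_vanish Pi) coefL_proj) ?addKn //.
by move=> eps _; rewrite /= coefL_mon1 eqxx.
Qed.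

End Split.

(** * Induced characters as sums over fixed words *)

(** The word whose stabilizer is the Young subgroup. *)
Definition last_word i : {ffun 'I_n -> bool} := [ffun k => in_last i k].

Lemma sgn_lastE i (s : 'S_n) : sgn_last F i s = inv_sign F (in_last i) s.
Proof.
rewrite /sgn_last /inv_sign -prodr_const big_mkcond [RHS]big_mkcond.
apply: eq_bigr => -[j k] _; rewrite inE /=.
by case: (in_last i j); case: (in_last i k); case: (j < k)%N; case: (_ < _)%N.
Qed.

(** Conjugation by [x] carries the Young subgroup to the stabilizer of the translated word, and the
    inversion sign follows by [inv_sign_conj]. *)
Lemma psi_young_conj i g x :
  psi_young F i (wmul (winv x) (wmul g x)) =
    signed_fix g (eps_act (last_word i) x.2^-1%g).
Proof.
set eps := eps_act _ _.
have epsE j : eps j = in_last i (x.2^-1%g j) by rewrite !ffunE.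
rewrite /psi_young /signed_fix /=.
have -> : in_young i (wmul (winv x) (wmul g x)) = (eps_act eps g.2 == eps).
  apply/forallP/eqP => [inY | /ffunP fix_eps k]; rewrite /=.
    apply/ffunP => j; rewrite ffunE !epsE.
    by have /eqP := inY (x.2^-1%g j); rewrite /= !permM permKV.
  by have := fix_eps (x.2 k); rewrite ffunE !epsE !permM permK => ->.
case: eqP => // /ffunP fix_eps.
have fixE j : eps (g.2 j) = eps j by have := fix_eps j; rewrite ffunE.
rewrite sgn_lastE; congr (_ * _).
  rewrite (reindex_inj (@perm_inj _ x.2^-1%g)) /=.
  rewrite (eq_bigl eps) => [|j]; last by rewrite -epsE.
  rewrite (eq_bigr (fun j => sgnb F (x.1 j) * sgnb F (g.1 j) *
      sgnb F (x.1 (g.2^-1%g j)))) => [|j _]; last first.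
    by rewrite !ffunE invgK permKV /sgnb !signr_addb mulrA.
  rewrite !big_split /= mulrAC -[RHS]mul1r; congr (_ * _).
  (* The signs of [x] occur at j and at the preimage of j under [g.2]; as the word is fixed, both
     run over its odd letters and cancel. *)
  rewrite [X in _ * X](reindex_inj (@perm_inj _ g.2)) /=.
  rewrite [X in _ * X](eq_big eps (fun j => sgnb F (x.1 j))); last first.
  - by move=> j _; rewrite permK.
  - by move=> j; rewrite fixE.
  by rewrite -big_split big1 // => j _; rewrite /= /sgnb -expr2 sqrr_sign.
rewrite (@eq_inv_sign F n eps (in_last i \o x.2^-1%g)) => [|j]; last by rewrite /= epsE.
by apply: inv_sign_conj => j; rewrite /= -!epsE fixE.
Qed.

(** For i > n the truncated difference n - i is 0 and the weight would be n, hence the bound. *)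
Lemma weight_last i : (i <= n)%N -> weight (last_word i) = i.
Proof.
move=> le_in; rewrite /weight (eq_bigr (fun k : 'I_n => (n - i <= k) : nat)%N).
  rewrite -(big_mkord xpredT (fun k => (n - i <= k) : nat)%N).
  rewrite (big_cat_nat (n := n - i)) ?leq_subr //= big_nat big1 ?add0n.
    rewrite big_nat (eq_bigr (fun=> 1%N)) => [|k /andP[->]//].
    by rewrite -big_nat sum_nat_const_nat muln1 subKn.
  by move=> k /andP[_]; rewrite ltnNge => /negPf->.
by move=> k _; rewrite ffunE.
Qed.

(** Words of equal weight contain each letter equally often, so as tuples they are rearrangements of
    each other. *)
Lemma eps_act_transitive eps eps' : weight eps = weight eps' ->
  exists s : 'S_n, eps = eps_act eps' s.
Proof.
move=> eq_w; pose t (e : {ffun 'I_n -> bool}) : n.-tuple bool := [tuple e k | k < n].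
have count_t e b : count_mem b (t e) = if b then weight e else (n - weight e)%N.
  have count1 : count_mem true (t e) = weight e.
    rewrite /= count_map -sum1_count big_mkcond big_enum /=.
    by apply: eq_bigr => k _; case: (e k).
  case: b => //; have := count_predC (pred1 true) (t e).
  rewrite size_tuple count1 => count_n.
  rewrite -[X in (X - _)%N]count_n addKn.
  by apply: eq_count => -[].
have /tuple_permP[s ets] : perm_eq (t eps) (t eps').
  by apply/allP => b _ /=; rewrite !count_t eq_w.
exists s; apply/ffunP => k; rewrite ffunE.
have := congr1 (nth false ^~ k) ets.
have nth_mk (h : 'I_n -> bool) : nth false [tuple h j | j < n] k = h k.
  by rewrite (nth_map k) ?size_enum_ord // nth_ord_enum.
by rewrite !nth_mk tnth_mktuple.
Qed.

(** The fiber is a coset of the Young subgroup, and [shift] is the translation onto it. *)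
Lemma card_fiber i (s : 'S_n) :
  #|[pred x : wr n | eps_act (last_word i) x.2^-1%g == eps_act (last_word i) s]| =
  #|[pred h : wr n | in_young i h]|.
Proof.
rewrite -!sum1_card.
pose shift (h : wr n) : wr n := (h.1, (h.2 * s^-1)%g).
have inj_shift : injective shift.
  by case=> [a t] [b u] [-> /mulIg->].
rewrite (reindex_inj inj_shift) /=; apply: eq_bigl => h; rewrite !inE /=.
apply/eqP/forallP => [/ffunP eq_s k | inY].
  have := eq_s (s^-1%g (h.2 k)); rewrite !ffunE invMg invgK !permM !permKV permK.
  by move->.
apply/ffunP => j; rewrite !ffunE invMg invgK permM.
by have /eqP := inY (h.2^-1%g (s j)); rewrite permKV => ->.
Qed.

(** Grouping [x] by the translated word, each word of weight i arises once per element of the Young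
    subgroup, which cancels the normalization. *)
Lemma chi_hookE (charF0 : [pchar F] =i pred0) i g : (i <= n)%N ->
  chi_hook F i g = \sum_(eps | weight eps == i) signed_fix g eps.
Proof.
move=> le_in; rewrite /chi_hook.
set H := #|_|; have H_gt0 : (0 < H)%N.
  by apply/card_gt0P; exists ([ffun=> false], 1%g); rewrite inE; apply/forallP => k; rewrite perm1.
have H_neq0 : H%:R != 0 :> F by rewrite (pcharf0P F).1 // -lt0n.
apply: (mulfI H_neq0); rewrite mulVKf //.
under eq_bigr do rewrite psi_young_conj.
rewrite (partition_big (fun x : wr n => eps_act (last_word i) x.2^-1%g)
  (fun eps => weight eps == i)) /=; last first.
  by move=> x _; rewrite weight_act weight_last.
rewrite mulr_sumr; apply: eq_bigr => eps /eqP w_eps.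
have [s ->] := @eps_act_transitive eps (last_word i) (etrans w_eps (esym (weight_last le_in))).
rewrite (eq_bigr (fun=> signed_fix g (eps_act (last_word i) s))) => [|x /eqP->//].
by rewrite sumr_const card_fiber mulr_natl.
Qed.

(** * Counting words by weight and parity *)

Lemma weight_le eps : (weight eps <= n)%N.
Proof.
rewrite -[X in (_ <= X)%N]card_ord -sum1_card; apply: leq_sum => j _.
exact: leq_b1.
Qed.

(** Stated for any commutative law, to serve both cardinals in [nat] and character sums in [F]. *)
Lemma big_weight (R : Type) (idx : R) (op : Monoid.com_law idx) (A : pred nat)
    (h : {ffun 'I_n -> bool} -> R) :
  \big[op/idx]_(eps | A (weight eps)) h eps =
  \big[op/idx]_(0 <= i < n.+1 | A i) \big[op/idx]_(eps | weight eps == i) h eps.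
Proof.
rewrite big_mkord (partition_big (fun eps => inord (weight eps) : 'I_n.+1)
  (fun i : 'I_n.+1 => A i)) /= => [|eps]; last first.
  by rewrite inordK // ltnS weight_le.
apply: eq_bigr => i Ai; apply: eq_bigl => eps.
rewrite -(inj_eq val_inj) /= inordK ?ltnS ?weight_le //.
by have [->|_] := eqVneq (weight eps) i; rewrite ?andbT ?andbF.
Qed.

Lemma card_weight i : #|[pred eps : {ffun 'I_n -> bool} | weight eps == i]| = 'C(n, i).
Proof.
rewrite -[n in RHS]card_ord -card_draws -!sum1_card.
have bij_w : bijective (fun A : {set 'I_n} => [ffun k => k \in A]).
  exists (fun eps : {ffun 'I_n -> bool} => [set k | eps k]).
    by move=> A; apply/setP => k; rewrite inE ffunE.
  by move=> eps; apply/ffunP => k; rewrite ffunE inE.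
rewrite (reindex _ (onW_bij _ bij_w)) /=; apply: eq_bigl => A; rewrite !inE.
congr (_ == _); rewrite -sum1_card big_mkcond; apply: eq_bigr => k _.
by rewrite ffunE; case: (_ \in _).
Qed.

Lemma card_weight_pred (A : pred nat) :
  #|[pred eps : {ffun 'I_n -> bool} | A (weight eps)]| = (\sum_(0 <= i < n.+1 | A i) 'C(n, i))%N.
Proof.
rewrite -sum1_card big_weight; apply: eq_bigr => i _.
by rewrite sum1_card card_weight.
Qed.

(** Flipping the letter of index 0, which exists since n > 0, exchanges the two parities. *)
Lemma card_weight_parity b : (0 < n)%N ->
  #|[pred eps : {ffun 'I_n -> bool} | odd (weight eps) == b]| = (2 ^ n.-1)%N.
Proof.
move=> n_gt0; pose k0 := Ordinal n_gt0.
pose flip eps : {ffun 'I_n -> bool} := [ffun k => eps k (+) (k == k0)].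
have flipK : involutive flip.
  by move=> eps; apply/ffunP => k; rewrite !ffunE addbK.
have odd_flip eps : odd (weight (flip eps)) = ~~ odd (weight eps).
  rewrite /weight !(bigD1 k0 (P := xpredT)) //= !oddD !oddb ffunE eqxx addbT addNb.
  by congr (~~ (_ (+) odd _)); apply: eq_bigr => k /negPf nk; rewrite ffunE nk addbF.
have card_flip b' : #|[pred eps : {ffun 'I_n -> bool} | odd (weight eps) == b']| =
    #|[pred eps : {ffun 'I_n -> bool} | odd (weight eps) == ~~ b']|.
  rewrite -!sum1_card (reindex_inj (inv_inj flipK)) /=.
  by apply: eq_bigl => eps; rewrite !inE odd_flip -[in RHS](inj_eq negb_inj) negbK.
have := cardC [pred eps : {ffun 'I_n -> bool} | odd (weight eps) == b].
rewrite card_ffun card_bool card_ord -[in (2 ^ n)%N](prednK n_gt0) expnS mul2n.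
rewrite [X in (_ + X)%N](_ : _ = #|[pred eps : {ffun 'I_n -> bool} | odd (weight eps) == ~~ b]|).
  by rewrite -card_flip addnn => /double_inj.
by apply: eq_card => eps; rewrite !inE; case: odd; case: b.
Qed.

End Characters.

Theorem theorem5p5 (F : fieldType) (charF0 : [pchar F] =i pred0)
  (n : nat) (hn : (0 < n)%N) :
  exists (UC UI : {vspace Pn F n}),
    (forall f : Pn F n, f \in UC <-> central_poly f) /\
    (forall f : Pn F n, f \in UI <-> identity_poly f) /\
    (* (1) codimension of central polynomials, and delta_n *)
    ((\dim (fullv : {vspace Pn F n}) - \dim UC)%N
       = (\sum_(1 <= i < n.+1 | odd i) 'C(n, i))%N /\
     (\dim (fullv : {vspace Pn F n}) - \dim UC)%N = (2 ^ n.-1)%N /\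
     (\dim UC - \dim UI)%N = (\sum_(0 <= i < n.+1 | ~~ odd i) 'C(n, i))%N /\
     (\dim UC - \dim UI)%N = (2 ^ n.-1)%N) /\
    (* (2) the corresponding characters *)
    (forall g : wr n,
       trace_on fullv g - trace_on UC g
         = \sum_(1 <= i < n.+1 | odd i) chi_hook F i g /\
       trace_on UC g - trace_on UI g
         = \sum_(0 <= i < n.+1 | ~~ odd i) chi_hook F i g).
Proof.
pose odd_word (eps : {ffun 'I_n -> bool}) := odd (weight eps).
pose even_word (eps : {ffun 'I_n -> bool}) := ~~ odd (weight eps).
(* Each set of conditions extends the previous one by a disjoint set of words, as [coefL_ker_dim]
   and [trace_split] require. *)
pose nonzero_C : pred {ffun 'I_n -> bool} := predU pred0 odd_word.
pose nonzero_I : pred {ffun 'I_n -> bool} := predU nonzero_C even_word.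
have odd_disj eps : odd_word eps -> ~~ pred0 eps by [].
have even_disj eps : even_word eps -> ~~ nonzero_C eps by [].
exists (coefL_ker F nonzero_C), (coefL_ker F nonzero_I).
(* The empty set of conditions cuts out the full space, which becomes the first kernel of the
   chain. *)
rewrite -(coefL_ker0 F n) !coefL_ker_dim //.
have -> : #|odd_word| = (2 ^ n.-1)%N.
  rewrite -(card_weight_parity true hn).
  by apply: eq_card => eps; rewrite !inE eqb_id.
have -> : #|even_word| = (2 ^ n.-1)%N.
  rewrite -(card_weight_parity false hn).
  by apply: eq_card => eps; rewrite !inE eqbF_neg.
have sum_odd : (2 ^ n.-1 = \sum_(1 <= i < n.+1 | odd i) 'C(n, i))%N.
  rewrite -(card_weight_parity true hn).
  (* The index 0 is even, so its term drops and the sum starts at 1. *)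
  have := card_weight_pred n odd; rewrite big_ltn_cond //= => <-.
  by apply: eq_card => eps; rewrite !inE eqb_id.
have sum_even : (2 ^ n.-1 = \sum_(0 <= i < n.+1 | ~~ odd i) 'C(n, i))%N.
  rewrite -(card_weight_parity false hn) -card_weight_pred.
  by apply: eq_card => eps; rewrite !inE eqbF_neg.
split; [|split; [|split; [by []|]]].
- move=> f; rewrite central_polyP //; apply: (iff_trans (coefL_kerP _ _)).
  by split.
- move=> f; rewrite identity_polyP; apply: (iff_trans (coefL_kerP _ _)).
  (* Odd and even words together exhaust all words. *)
  by split=> f0 eps => [|_]; apply: f0; exact: orbN.
move=> g; split.
  rewrite trace_split // => [|eps]; last by rewrite /odd_word weight_act.
  rewrite (big_weight _ odd) big_ltn_cond //= big_nat_cond [RHS]big_nat_cond.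
  by apply: eq_bigr => i /andP[/andP[_ le_in] _]; rewrite chi_hookE.
rewrite trace_split // => [|eps|eps].
- rewrite (big_weight _ (fun i => ~~ odd i)) big_nat_cond [RHS]big_nat_cond.
  by apply: eq_bigr => i /andP[/andP[_ le_in] _]; rewrite chi_hookE.
- by rewrite /even_word weight_act.
- by rewrite /nonzero_C /= /odd_word weight_act.
Qed.
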